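(* For every simple lattice polytope $\Delta$ of dimension $n$ and every $p=0,1,\dots,n$, $$\sum_{j=0}^p(-1)^j\binom{n-j}{p-j}\sum_{F\in\mathcal F_{n-j}(\Delta)}l(F)=\sum_{s=p}^n\binom{s}{p}\sum_{\Gamma\in\mathcal F_s(\Delta)}l^*(\Gamma).$$
   Context: A lattice polytope is the convex hull of finitely many points of a lattice $M\cong\mathbb Z^n$ in $M_{\mathbb R}$; it is simple if exactly $n$ edges meet at each vertex. $\mathcal F_k(\Delta)$ is the set of $k$-dimensional faces of $\Delta$, $l(F)$ the number of lattice points in $F$, and $l^*(\Gamma)$ the number of lattice points in the relative interior of $\Gamma$ (for a vertex, $l^*=1$). *)

(* Defs.v *)
From HB Require Import structures.
From mathcomp Require Import all_boot all_order all_algebra.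
From mathcomp Require Import boolp classical_sets functions cardinality fsbigop reals.
Set Implicit Arguments. Unset Strict Implicit. Unset Printing Implicit Defensive.
Import Order.TTheory GRing.Theory Num.Theory.
Local Open Scope classical_set_scope.
Local Open Scope ring_scope.

Section Polytopes.
Variables (R : realType) (n : nat).

Definition intpt (z : 'rV[int]_n) : 'rV[R]_n := map_mx (fun k : int => k%:~R) z.

Definition conv (V : seq 'rV[R]_n) : set 'rV[R]_n :=
  [set x | exists w : 'I_(size V) -> R,
     (forall i, 0 <= w i) /\ \sum_(i < size V) w i = 1 /\
     x = \sum_(i < size V) w i *: V`_i].

Definition lattice_polytope (V : seq 'rV[int]_n) : set 'rV[R]_n :=
  conv (map intpt V).

Definition dotv (c x : 'rV[R]_n) : R := \sum_(i < n) c 0 i * x 0 i.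

(* nonempty faces of P: intersections of P with supporting hyperplanes
   (c = 0, b = 0 gives P itself) *)
Definition is_face (P F : set 'rV[R]_n) : Prop :=
  exists (c : 'rV[R]_n) (b : R),
    (forall x, P x -> dotv c x <= b) /\
    F = [set x | P x /\ dotv c x = b] /\ F !=set0.

Definition affdim_ge (S : set 'rV[R]_n) (k : nat) : Prop :=
  exists p : 'I_k.+1 -> 'rV[R]_n,
    (forall i, S (p i)) /\
    row_free (\matrix_(i < k) (p (lift ord0 i) - p ord0)).

Definition has_dim (S : set 'rV[R]_n) (k : nat) : Prop :=
  affdim_ge S k /\ ~ affdim_ge S k.+1.

Definition faces (P : set 'rV[R]_n) (k : nat) : set {classic (set 'rV[R]_n)} :=
  [set F | is_face P F /\ has_dim F k].

Definition aff (S : set 'rV[R]_n) : set 'rV[R]_n :=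
  [set x | exists (m : nat) (q : 'I_m -> 'rV[R]_n) (w : 'I_m -> R),
     (forall i, S (q i)) /\ \sum_(i < m) w i = 1 /\
     x = \sum_(i < m) w i *: q i].

Definition relint (S : set 'rV[R]_n) : set 'rV[R]_n :=
  [set x | S x /\ exists e : R, 0 < e /\
     forall y, aff S y -> (forall i, `|y 0 i - x 0 i| < e) -> S y].

Definition ncard (T : choiceType) (A : set T) : int := \sum_(a \in A) (1 : int).

Definition lpts (F : set 'rV[R]_n) : int :=
  ncard [set z : 'rV[int]_n | F (intpt z)].
Definition lpts_int (F : set 'rV[R]_n) : int :=
  ncard [set z : 'rV[int]_n | relint F (intpt z)].

Definition simple_polytope (P : set 'rV[R]_n) : Prop :=
  forall v, v \in faces P 0 ->
    ([set E : {classic (set 'rV[R]_n)} | E \in faces P 1 /\ v `<=` E]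
      #= `I_n)%card.

End Polytopes.

(* Main.v *)
(* The faces of a polytope partition it into relative interiors, so both sides
   are sums over the lattice points x of the polytope, and the identity may be
   checked at each x.  Let d be the dimension of the face carrying x, and v a
   vertex of that face.  The tangent cone at v is generated by its edges; as
   there are only n of them and the polytope is full dimensional, they form a
   basis in which the tangent cone is the positive orthant.  Hence the faces
   through v are cut out by the vanishing of a set K of edge coordinates, and
   have dimension n - #K.  The faces through x are those for which K consists of
   zero coordinates of x, so 'C(n - d, j) of them have dimension n - j, and the
   statement reduces to
     \sum_j (-1)^j 'C(n - j, p - j) 'C(n - d, j) = 'C(d, p).
   Both the existence of the carrying face and the fact that a minimal set of
   generators of the tangent cone consists of edges come from Gordan's theorem of
   the alternative. *)
Require Import Defs.
From HB Require Import structures.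
From mathcomp Require Import all_boot all_order all_algebra.
From mathcomp Require Import boolp classical_sets functions cardinality fsbigop reals.
From mathcomp Require Import ring lra zify.
Import Order.TTheory GRing.Theory Num.Theory.
Local Open Scope classical_set_scope.
Local Open Scope ring_scope.

Set Implicit Arguments.
Unset Strict Implicit.
Unset Printing Implicit Defensive.

(** * The inner product *)

Section Dotv.
Variables (R : realType) (n : nat).
Implicit Types (c x y : 'rV[R]_n) (a : R).

Lemma dotvE c x : dotv c x = (x *m c^T) 0 0.
Proof.
rewrite /dotv !mxE; apply: eq_bigr => i _; by rewrite !mxE mulrC.
Qed.

Lemma dotvDr c x y : dotv c (x + y) = dotv c x + dotv c y.
Proof. by rewrite !dotvE mulmxDl mxE. Qed.

Lemma dotvZr c a x : dotv c (a *: x) = a * dotv c x.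
Proof. by rewrite !dotvE -scalemxAl mxE. Qed.

Lemma dotvBr c x y : dotv c (x - y) = dotv c x - dotv c y.
Proof. by rewrite -scaleN1r dotvDr dotvZr mulN1r. Qed.

Lemma dotv0r c : dotv c 0 = 0.
Proof. by rewrite -(subrr 0) dotvBr subrr. Qed.

Lemma dotv_sumr c (I : Type) (r : seq I) (P : pred I) (F : I -> 'rV[R]_n) :
  dotv c (\sum_(i <- r | P i) F i) = \sum_(i <- r | P i) dotv c (F i).
Proof. by apply: (big_morph (dotv c)); [exact: dotvDr | exact: dotv0r]. Qed.

Lemma dotvC x y : dotv x y = dotv y x.
Proof. by apply: eq_bigr => i _; rewrite mulrC. Qed.

Lemma dotvDl x y c : dotv (x + y) c = dotv x c + dotv y c.
Proof. by rewrite ![dotv _ c]dotvC dotvDr. Qed.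

Lemma dotvZl a x c : dotv (a *: x) c = a * dotv x c.
Proof. by rewrite ![dotv _ c]dotvC dotvZr. Qed.

Lemma dotvBl x y c : dotv (x - y) c = dotv x c - dotv y c.
Proof. by rewrite ![dotv _ c]dotvC dotvBr. Qed.

Lemma dotvv_ge0 x : 0 <= dotv x x.
Proof. by apply: sumr_ge0 => i _; rewrite -expr2 sqr_ge0. Qed.

Lemma dotvv_eq0 x : (dotv x x == 0) = (x == 0).
Proof.
apply/idP/eqP => [|->]; last by rewrite dotv0r.
rewrite psumr_eq0 => [/allP h|i _]; last by rewrite -expr2 sqr_ge0.
apply/rowP => i; rewrite mxE; apply/eqP; rewrite -sqrf_eq0 expr2.
by apply: h; rewrite mem_index_enum.
Qed.

Lemma dotvv_gt0 x : (0 < dotv x x) = (x != 0).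
Proof. by rewrite lt_def dotvv_ge0 dotvv_eq0 andbT. Qed.

End Dotv.

(** * Theorems of the alternative *)

Lemma finite_domination (R : realFieldType) (T : finType) (P : pred T)
    (a b : T -> R) :
  (forall i, P i -> 0 < a i) ->
  exists2 N : R, 0 < N & forall i, P i -> b i < N * a i.
Proof.
(* The witness will be [1 + S]: the sum bounds every ratio [b i / a i], and the [1] makes the bounds
   strict and the witness positive. *)
move=> a_gt0; pose S := \sum_(i | P i) (`|b i| / a i).
have t_ge0 i : P i -> 0 <= `|b i| / a i.
  by move=> Pi; rewrite divr_ge0 // ltW // a_gt0.
exists (1 + S) => [|i Pi]; first by rewrite ltr_wpDr // sumr_ge0.
rewrite -ltr_pdivrMr ?a_gt0 // (@le_lt_trans _ _ (`|b i| / a i)) //.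
  by rewrite ler_pM2r ?invr_gt0 ?a_gt0 // ler_norm.
rewrite (@le_lt_trans _ _ S) ?ltrDr // /S (bigD1 i) //= lerDl.
by rewrite sumr_ge0 // => j /andP[Pj _]; exact: t_ge0.
Qed.

(** Induction on [s]. A functional positive on the tail and nonnegative at a nonzero head is tilted
    towards the head; one negative at the head serves to project the tail along the head.
    Coefficients are indexed by [T], so [uniq s] lets the head receive its own. *)
Lemma gordan (R : realType) (n : nat) (T : finType) (s : seq T) (x : T -> 'rV[R]_n) :
  uniq s ->
  (exists d, forall i, i \in s -> 0 < dotv d (x i)) \/
  (exists2 a : T -> R, forall i, i \in s -> 0 <= a i &
     (exists2 i, i \in s & 0 < a i) /\ \sum_(i <- s) a i *: x i = 0).
Proof.
elim: s x => [|t s IH] x /=; first by left; exists 0.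
case/andP=> tNs us; have neq_t i : i \in s -> i != t.
  by apply: contraTneq => ->.
have perturb d : x t != 0 -> (forall i, i \in s -> 0 < dotv d (x i)) ->
    0 <= dotv d (x t) ->
    exists d, forall i, i \in t :: s -> 0 < dotv d (x i).
  move=> xt0 dP dt.
  have [N N0 NP] := @finite_domination R T [in s] (fun i => dotv d (x i))
    (fun i => - dotv (x t) (x i)) dP.
  exists (N *: d + x t) => i; rewrite inE dotvDl dotvZl => /predU1P[->|iS].
    by rewrite ltr_wpDl ?mulr_ge0 ?dotvv_gt0 // ltW.
  by rewrite -ltrBlDr sub0r; exact: NP.
have [[d dP]|[a a0 [[i iS ai] as0]]] := IH x us; last first.
  right; exists (fun i => if i == t then 0 else a i) => [i'|].
    by rewrite inE => /predU1P[->|/[dup]/neq_t/negPf->]; rewrite ?eqxx //; exact: a0.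
  split; first by exists i; rewrite ?inE ?iS ?orbT // (negPf (neq_t _ iS)).
  rewrite big_cons eqxx scale0r add0r -[RHS]as0; apply: eq_big_seq => j jS.
  by rewrite (negPf (neq_t _ jS)).
have [xt0|xt0] := eqVneq (x t) 0.
  right; exists (fun i => (i == t)%:R) => [i' _|]; first by case: (i' == t).
  split; first by exists t; rewrite ?inE ?eqxx.
  rewrite big_cons xt0 scaler0 add0r big_seq big1 // => j jS.
  by rewrite (negPf (neq_t _ jS)) scale0r.
have [dt|dt] := leP 0 (dotv d (x t)); first by left; exact: perturb dt.
(* project along [x t] onto the hyperplane orthogonal to [d] *)
pose r i := dotv d (x i) / - dotv d (x t).
have dt' : 0 < - dotv d (x t) by rewrite oppr_gt0.
have [[e eP]|[a a0 [[i iS ai] as0]]] := IH (fun i => x i + r i *: x t) us.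
  (* [d'] kills [x t] and takes on each [x i] of the tail the value of [e] at its projection. *)
  pose d' := e - (dotv e (x t) / dotv d (x t)) *: d.
  left; apply: (perturb d') => // [i iS|].
    suff -> : dotv d' (x i) = dotv e (x i + r i *: x t) by exact: eP.
    rewrite /d' /r dotvDr dotvBl dotvZl dotvZr invrN; ring.
  by rewrite dotvBl dotvZl divfK ?subrr // lt_eqF.
(* Expanding the projections in the relation, [x t] collects the coefficients [a i * r i], which are
   nonnegative. *)
right; exists (fun i => if i == t then \sum_(i <- s) a i * r i else a i) => [i'|].
  have S0 : 0 <= \sum_(i <- s) a i * r i.
    by rewrite big_seq sumr_ge0 // => j jS; rewrite mulr_ge0 ?a0 ?divr_ge0 ?ltW ?dP.
  by rewrite inE => /predU1P[->|/[dup]/neq_t/negPf->]; rewrite ?eqxx //; exact: a0.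
split; first by exists i; rewrite ?inE ?iS ?orbT // (negPf (neq_t _ iS)).
rewrite big_cons eqxx -[RHS]as0 scaler_suml addrC -big_split /=.
apply: eq_big_seq => j jS; rewrite (negPf (neq_t _ jS)).
by rewrite scalerDr scalerA.
Qed.

(** Gordan's theorem in the quotient by the row space of [B]: [cokermx B] is the quotient map, and
    its transpose pulls functionals back. *)
Lemma gordan_mod (R : realType) (n m : nat) (T : finType) (A : {set T})
    (x : T -> 'rV[R]_n) (B : 'M[R]_(m, n)) :
  (exists2 d, forall i, i \in A -> 0 < dotv d (x i) &
     forall y, (y <= B)%MS -> dotv d y = 0) \/
  (exists2 a : T -> R, forall i, i \in A -> 0 <= a i &
     (exists2 i, i \in A & 0 < a i) /\ ((\sum_(i in A) a i *: x i)%R <= B)%MS).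
Proof.
have [[e eP]|[a a0 [[i iA ai] as0]]] :=
    gordan (fun i => x i *m cokermx B) (enum_uniq A).
  have dE y : dotv (e *m (cokermx B)^T) y = dotv e (y *m cokermx B).
    by rewrite !dotvE trmx_mul trmxK mulmxA.
  left; exists (e *m (cokermx B)^T) => [i iA|y].
    by rewrite dE; apply: eP; rewrite mem_enum.
  by rewrite submxE dE => /eqP->; rewrite dotv0r.
right; exists a => [j jA|]; first by rewrite a0 ?mem_enum.
split; first by exists i; rewrite // -mem_enum.
rewrite submxE mulmx_suml -[X in X == _]big_enum /=; apply/eqP.
by rewrite -[RHS]as0; apply: eq_bigr => j _; rewrite scalemxAl.
Qed.

(** From [x] one can move a little away from any [y] of [F] and stay in [F]. A functional that is
    maximal on [P] at [x] cannot grow in that direction, so it is no smaller at [y] than at [x]. *)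
Lemma relint_sub_face (R : realType) (n : nat) (P F G : set 'rV[R]_n) x :
  F `<=` P -> is_face P G -> relint F x -> G x -> F `<=` G.
Proof.
move=> FP [c [b [cP [-> _]]]] [Fx [e [e0 eF]]] [Px cx] y Fy.
split; first exact: FP.
apply/le_anti/andP; split; first exact/cP/FP.
pose S := \sum_i `|x 0 i - y 0 i|.
have S0 : 0 <= S by apply: sumr_ge0.
(* With this [t], every coordinate of [t *: (x - y)] is below [e] in absolute value. *)
pose t := e / (1 + S); have t0 : 0 < t by rewrite divr_gt0 // ltr_wpDr.
have /FP/cP : F (x + t *: (x - y)).
  apply: eF => [|i]; last first.
    rewrite !mxE [x 0 i + _]addrC addrK normrM gtr0_norm // mulrAC ltr_pdivrMr ?ltr_wpDr //.
    rewrite ltr_pM2l // (@le_lt_trans _ _ S) ?ltrDr //.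
    by rewrite /S (bigD1 i) //= lerDl sumr_ge0.
  exists 2, (fun i => if i == 0 then x else y),
    (fun i => if i == 0 then 1 + t else - t); split.
    by move=> i; case: (i == 0).
  by rewrite !big_ord_recl !big_ord0 /= !addr0 addrK scalerBr scalerDl scale1r
    scaleNr addrA.
by rewrite dotvDr dotvZr dotvBr cx gerDl pmulr_rle0 // subr_le0.
Qed.

(** * Convex hulls of finite families: carrying faces and vertices *)

Section Hull.
Variables (R : realType) (n m : nat) (a : 'I_m -> 'rV[R]_n).
Implicit Types (x y c : 'rV[R]_n) (w : 'I_m -> R).

Definition weights w x :=
  [/\ forall i, 0 <= w i, \sum_i w i = 1 & x = \sum_i w i *: a i].

Definition hull : set 'rV[R]_n := [set x | exists w, weights w x].

Lemma hull_mem i : hull (a i).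
Proof.
exists (fun j => (j == i)%:R); split=> [j||]; first by rewrite ler0n.
  by rewrite (bigD1 i) //= big1 ?eqxx ?addr0 // => j /negPf->.
rewrite (bigD1 i) //= big1 ?eqxx ?scale1r ?addr0 // => j /negPf->.
by rewrite scale0r.
Qed.

Lemma weights_sumB w x y :
  weights w x -> \sum_i w i *: (a i - y) = x - y.
Proof.
case=> _ w1 ->; under eq_bigr do rewrite scalerBr.
by rewrite sumrB -scaler_suml w1 scale1r.
Qed.

Lemma weights_dotvB w x c (b : R) :
  weights w x -> \sum_i w i * (b - dotv c (a i)) = b - dotv c x.
Proof.
case=> _ w1 ->; under eq_bigr do rewrite mulrBr.
rewrite sumrB -mulr_suml w1 mul1r dotv_sumr.
by congr (_ - _); apply: eq_bigr => i _; rewrite dotvZr.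
Qed.

Lemma hull_le c b x : (forall i, dotv c (a i) <= b) -> hull x -> dotv c x <= b.
Proof.
move=> cb [w wx]; rewrite -subr_ge0 -(weights_dotvB _ _ wx).
by apply: sumr_ge0 => i _; rewrite mulr_ge0 ?subr_ge0 //; case: wx.
Qed.

Lemma weights_face c b w x : (forall i, dotv c (a i) <= b) -> weights w x ->
  dotv c x = b -> forall i, 0 < w i -> dotv c (a i) = b.
Proof.
move=> cb wx cx i wi; have /eqP := weights_dotvB c b wx.
have [w0 _ _] := wx.
rewrite cx subrr psumr_eq0; last by move=> j _; rewrite mulr_ge0 ?subr_ge0.
move=> /allP/(_ i (mem_index_enum i)) /=.
by rewrite mulf_eq0 (gt_eqF wi) /= subr_eq0 eq_sym => /eqP.
Qed.

Lemma hull_face c b i : (forall i, dotv c (a i) <= b) -> dotv c (a i) = b ->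
  is_face hull [set x | hull x /\ dotv c x = b].
Proof.
move=> cb ci; exists c, b; split; first by move=> x; exact: hull_le.
by split=> //; exists (a i); split=> //; exact: hull_mem.
Qed.

(** For each index choose weights of [x] that are positive there if any are; the average of these
    choices has the largest possible support. *)
Lemma max_weights x : hull x ->
  exists2 w, weights w x & forall w', weights w' x -> forall i, 0 < w' i -> 0 < w i.
Proof.
move=> [w0 w0x].
have m0 : (0 < m)%N.
  case: w0x => _ + _; case: (m) w0 => // w0.
  by rewrite big_ord0 => /eqP; rewrite eq_sym oner_eq0.
have : forall i, exists w, weights w x /\
    forall w', weights w' x -> 0 < w' i -> 0 < w i.
  move=> i; have [[w [wx wi]]|N] := pselect (exists w, weights w x /\ 0 < w i).
    by exists w.
  by exists w0; split=> // w' w'x w'i; case: N; exists w'.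
move=> /choice[W WP].
have m0' : m%:R != 0 :> R by rewrite pnatr_eq0 -lt0n.
have W0 i j : 0 <= W i j by have [[]] := WP i.
exists (fun j => m%:R^-1 * \sum_i W i j); first split=> [j||].
- by rewrite mulr_ge0 ?invr_ge0 ?ler0n // sumr_ge0.
- rewrite -mulr_sumr exchange_big /=.
  under eq_bigr => i _ do have [[_ -> _] _] := WP i.
  by rewrite sumr_const card_ord mulVf.
- under eq_bigr do rewrite -scalerA scaler_suml.
  rewrite -scaler_sumr exchange_big /=.
  under eq_bigr => i _ do have [[_ _ <-] _] := WP i.
  by rewrite sumr_const card_ord -scaler_nat scalerA mulVf // scale1r.
move=> w' w'x i w'i; rewrite mulr_gt0 ?invr_gt0 ?ltr0n //.
rewrite (bigD1 i) //= ltr_wpDr //; first by apply: sumr_ge0.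
by have [_] := WP i; apply; first exact: w'x.
Qed.

(** Let [I] be the largest support of weights of [x]. Gordan's theorem modulo the span of the
    [a i - x] with [i] in [I] gives either weights with a larger support, which is absurd, or a
    functional whose maximal face has exactly the generators in [I]. All of these have positive
    weight at [x], so [x] is interior to that face. *)
Lemma carrier_face x : hull x -> exists F, is_face hull F /\ relint F x.
Proof.
move=> /[dup] hx /max_weights[w wx wmax].
have [w0 w1 xE] := wx.
pose I := [set i | 0 < w i]%SET.
pose B := \matrix_i (if i \in I then a i - x else 0).
have rowB i : row i B = if i \in I then a i - x else 0 by rewrite rowK.
have mulB (g : 'rV_m) :
    g *m B = \sum_i (if i \in I then g 0 i else 0) *: (a i - x).
  rewrite mulmx_sum_row; apply: eq_bigr => i _; rewrite rowB.
  by case: ifP => _ //; rewrite scaler0 scale0r.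
have [[d dP dB]|[al al0 [[k kI alk] /submxP[g gE]]]] :=
    gordan_mod (~: I) (fun i => a i - x) B; last first.
  have wI i : i \in I -> 0 < w i by rewrite inE.
  have [N N0 NP] := @finite_domination R _ [in I] w (fun i => g 0 i) wI.
  (* The relation found by Gordan has coefficients [al] outside [I] and [- g] on [I]. Adding [N]
     times the relation with coefficients [w] makes it nonnegative; normalised, it yields weights of
     [x] that are positive at [k], outside [I]. *)
  pose be i := N * w i + (if i \in I then - g 0 i else al i).
  have be0 i : 0 <= be i.
    rewrite /be; case: ifPn => [iI|iI]; first by rewrite subr_ge0 ltW // NP.
    by rewrite addr_ge0 ?mulr_ge0 ?(ltW N0) // al0 // inE.
  have bek : 0 < be k.
    rewrite /be; move: kI; rewrite finset.in_setC => /negPf->.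
    by rewrite ltr_wpDl // mulr_ge0 // ltW.
  have S0 : 0 < \sum_i be i by rewrite (bigD1 k) //= ltr_wpDr // sumr_ge0.
  have beE : \sum_i be i *: (a i - x) = 0.
    under eq_bigr do rewrite scalerDl -scalerA.
    rewrite big_split /= -scaler_sumr (weights_sumB _ wx) subrr scaler0 add0r.
    apply: etrans (_ : \sum_(i in ~: I) al i *: (a i - x) - g *m B = 0); last first.
      by rewrite gE subrr.
    rewrite mulB [X in _ = X - _]big_mkcond /= -sumrB. apply: eq_bigr => i _.
    rewrite finset.in_setC; case: ifP => _ /=; first by rewrite sub0r scaleNr.
    by rewrite scale0r subr0.
  have /wmax/(_ k) : weights (fun i => be i / \sum_i be i) x.
    split=> [i||]; first by rewrite divr_ge0 // ltW.
      by rewrite -mulr_suml divff // gt_eqF.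
    under eq_bigr do rewrite mulrC -scalerA.
    rewrite -scaler_sumr; apply: (scalerI (lt0r_neq0 S0)).
    rewrite scalerA divff ?gt_eqF // scale1r; apply/esym/eqP.
    rewrite -subr_eq0 -[X in _ == X]beE; apply/eqP.
    by under [RHS]eq_bigr do rewrite scalerBr; rewrite sumrB -scaler_suml.
  by rewrite divr_gt0 // => /(_ isT); move: kI; rewrite !inE => /negPf->.
pose c := (-1) *: d.
have cI i : i \in I -> dotv c (a i) = dotv c x.
  move=> iI; apply/eqP; rewrite -subr_eq0 -dotvBr dotvZl dB ?mulr0 //.
  by have := row_sub i B; rewrite rowB iI.
have cN i : i \notin I -> dotv c (a i) < dotv c x.
  move=> iI; rewrite -subr_lt0 -dotvBr dotvZl mulN1r oppr_lt0.
  by apply: dP; rewrite finset.in_setC.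
have cle i : dotv c (a i) <= dotv c x.
  by have [/cI->|/cN/ltW] := boolP (i \in I).
exists [set y | hull y /\ dotv c y = dotv c x]; split.
  exists c, (dotv c x); split; first by move=> y; exact: hull_le.
  by split=> //; exists x.
split=> //.
(* If the coordinates of [y - x] are below [N^-1], its coefficients over the rows of [B] are at most
   [M k / N]. The [N] chosen next is so large that such a change keeps the weights on [I]
   nonnegative. *)
pose M k := \sum_l `|pinvmx B l k|.
have M0 k : 0 <= M k by exact: sumr_ge0.
have wI i : i \in I -> 0 < w i by rewrite inE.
have wN i : i \notin I -> w i = 0.
  by rewrite inE -leNgt => wi; apply/le_anti; rewrite wi w0.
have [N N0 NP] := @finite_domination R _ [in I] w
  (fun i => w i * (\sum_k M k) + M i) wI.
exists N^-1; split; first by rewrite invr_gt0.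
move=> y [r [q [om [qF [om1 yE]]]]] yx.
have yB : (y - x <= B)%MS.
  have -> : y - x = \sum_j om j *: (q j - x).
    under eq_bigr do rewrite scalerBr.
    by rewrite sumrB -yE -scaler_suml om1 scale1r.
  apply: summx_sub => j _; apply: scalemx_sub.
  have [[u ux] cq] := qF j; rewrite -(weights_sumB _ ux).
  apply: summx_sub => i _; have [iI|iI] := boolP (i \in I).
    by apply: scalemx_sub; have := row_sub i B; rewrite rowB iI.
  have [u0 _ _] := ux.
  have -> : u i = 0.
    apply/eqP; rewrite eq_le u0 andbT leNgt; apply/negP => ui.
    by have := cN _ iI; rewrite (weights_face cle ux cq ui) ltxx.
  by rewrite scale0r sub0mx.
pose g := (y - x) *m pinvmx B.
have gM k : N * `|g 0 k| <= M k.
  rewrite -ler_pdivlMl // mxE /M mulr_sumr (le_trans (ler_norm_sum _ _ _)) //.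
  apply: ler_sum => l _; rewrite normrM ler_wpM2r //.
  by rewrite ltW // mxE [X in _ + X]mxE.
(* Rows of [B] outside [I] are zero, so their coefficients in [g] are arbitrary and are replaced by
   0. *)
pose h i := if i \in I then g 0 i else 0.
have hg i : `|h i| <= `|g 0 i| by rewrite /h; case: ifP; rewrite // normr0.
have yE' : y = x + \sum_i h i *: (a i - x).
  by rewrite -mulB /g mulmxKpV // addrC subrK.
have hy : hull y.
  (* These are the coefficients of [x + \sum_i h i *: (a i - x)] once [x] is expanded with the
     weights [w]. *)
  exists (fun i => w i - w i * (\sum_j h j) + h i); split=> [i||].
  - have [iI|iI] := boolP (i \in I); last first.
      by rewrite /h (wN _ iI) (negPf iI) mul0r subrr addr0.
    have H1 : N * `|\sum_j h j| <= \sum_k M k.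
      rewrite (@le_trans _ _ (N * \sum_j `|h j|)) //.
        by rewrite ler_pM2l // ler_norm_sum.
      rewrite mulr_sumr; apply: ler_sum => j _.
      by rewrite (le_trans _ (gM j)) // ler_pM2l.
    have H2 : N * `|h i| <= M i by rewrite (le_trans _ (gM i)) // ler_pM2l.
    have H3 := NP i iI; have H4 := wI i iI.
    rewrite -(pmulr_rge0 _ N0) mulrDr mulrBr.
    have H5 : w i * (N * (\sum_j h j)) <= w i * (\sum_k M k).
      rewrite ler_pM2l // (le_trans _ H1) // ler_pM2l // ler_norm //.
    have H6 : - (N * h i) <= M i.
      by rewrite -mulrN (le_trans _ H2) // ler_pM2l // -normrN ler_norm.
    lra.
  - by rewrite big_split /= sumrB -mulr_suml w1 mul1r subrK.
  - have E1 : \sum_i h i *: (a i - x) = \sum_i h i *: a i - (\sum_i h i) *: x.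
      by under eq_bigr do rewrite scalerBr; rewrite sumrB scaler_suml.
    have -> : \sum_i (w i - w i * (\sum_j h j) + h i) *: a i =
        x - (\sum_j h j) *: x + \sum_i h i *: a i.
      under eq_bigr do rewrite scalerDl scalerBl mulrC -scalerA.
      by rewrite big_split /= sumrB -scaler_sumr -xE.
    by rewrite yE' E1 addrA addrAC.
split=> //; rewrite yE' dotvDr dotv_sumr big1 ?addr0 // => i _.
rewrite dotvZr /h; case: ifPn => [/cI|]; last by rewrite mul0r.
by rewrite dotvBr => ->; rewrite subrr mulr0.
Qed.

(** A generator [a i] of largest norm on [F] is a vertex: the functional [N *: c + a i] is maximal
    there only. Off [F] the term [N *: c] decides; on [F], the positivity of the squared distance
    from [a i]. *)
Lemma face_vertex F : is_face hull F ->
  exists2 i, is_face hull [set a i] & F (a i).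
Proof.
move=> [c [b [cP [FE [x0]]]]]; rewrite FE => -[[w wx] cx].
have cle i : dotv c (a i) <= b by apply/cP/hull_mem.
have [i0 ci0] : exists i, dotv c (a i) == b.
  apply: contrapT => N; have [w0 w1 _] := wx.
  have w00 i : w i = 0.
    apply/eqP; rewrite eq_le w0 andbT leNgt; apply/negP => wi.
    by apply: N; exists i; rewrite (weights_face cle wx cx wi).
  by move/eqP: w1; rewrite big1 // eq_sym oner_eq0.
case: (@Order.TotalTheory.arg_maxP _ _ _ i0 (fun i => dotv c (a i) == b)
  (fun i => dotv (a i) (a i)) ci0) => i /eqP ci imax.
have [N N0 NP] := @finite_domination R _ (fun j => dotv c (a j) < b)
  (fun j => b - dotv c (a j)) (fun j => dotv (a i) (a j) - dotv (a i) (a i))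
  (fun j => eqbRL (subr_gt0 _ _)).
pose c' := N *: c + a i; pose b' := N * b + dotv (a i) (a i).
have c'lt j : a j != a i -> dotv c' (a j) < b'.
  move=> ji; rewrite dotvDl dotvZl; have := cle j.
  rewrite le_eqVlt => /predU1P[cj|/NP]; last by rewrite /b'; lra.
  have aj : dotv (a j) (a j) <= dotv (a i) (a i) by apply: imax; rewrite cj.
  rewrite cj ltrD2l.
  have : 0 < dotv (a i - a j) (a i - a j) by rewrite dotvv_gt0 subr_eq0 eq_sym.
  rewrite dotvBl !dotvBr [dotv (a j) (a i)]dotvC.
  by move: aj; lra.
have c'i : dotv c' (a i) = b' by rewrite dotvDl dotvZl ci.
have c'le j : dotv c' (a j) <= b'.
  by have [->|/c'lt/ltW//] := eqVneq (a j) (a i); rewrite c'i.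
exists i; last by split=> //; exact: hull_mem.
suff -> : [set a i] = [set x | hull x /\ dotv c' x = b'] by exact: hull_face c'i.
apply/seteqP; split=> [_ ->|y [[u ux] cy]]; first by split; [exact: hull_mem|].
have [u0 u1 ->] := ux.
suff -> : \sum_j u j *: a j = \sum_j u j *: a i.
  by rewrite -scaler_suml u1 scale1r.
apply: eq_bigr => j _; have [->|/c'lt ji] := eqVneq (a j) (a i); first by [].
have [uj|] := ltrP 0 (u j); last first.
  by move=> uj; have -> : u j = 0; [apply/le_anti; rewrite uj u0|rewrite !scale0r].
by move: ji; rewrite (weights_face c'le ux cy uj) ltxx.
Qed.

End Hull.

(** * Finitely generated cones and minimal generators *)

Section Cone.
Variables (R : realType) (n m : nat) (u : 'I_m -> 'rV[R]_n).
Implicit Types (J : {set 'I_m}).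

Definition cone J : set 'rV[R]_n := [set y | exists w : 'I_m -> R,
  (forall j, 0 <= w j) /\ y = \sum_(j in J) w j *: u j].

Lemma cone_sum J (w : 'I_m -> R) :
  (forall j, 0 <= w j) -> (forall i, cone J (u i)) -> cone J (\sum_i w i *: u i).
Proof.
move=> w0 /choice[W WP]; exists (fun j => \sum_i w i * W i j); split=> [j|].
  by apply: sumr_ge0 => i _; rewrite mulr_ge0 //; have [] := WP i.
under [RHS]eq_bigr do rewrite scaler_suml.
rewrite exchange_big /=; apply: eq_bigr => i _.
have [_ ->] := WP i; rewrite scaler_sumr; apply: eq_bigr => j _.
by rewrite scalerA.
Qed.

(** Take [J] minimal for inclusion among generating sets; a generator lying in the cone of the
    others could be substituted away. *)
Lemma minimal_generators : exists J, (forall i, cone J (u i)) /\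
  forall j, j \in J -> ~ cone (J :\ j)%SET (u j).
Proof.
pose gen J := `[< forall i, cone J (u i) >].
have genT : gen [set: 'I_m]%SET.
  apply/asboolP => i; exists (fun j => (j == i)%:R); split=> [j|].
    by rewrite ler0n.
  rewrite (bigD1 i) ?inE //= eqxx scale1r big1 ?addr0 // => j /andP[_ /negPf->].
  by rewrite scale0r.
have [J /minsetP[/asboolP genJ Jmin] _] := minset_exists genT.
exists J; split=> // j jJ [w [w0 uE]].
suff genJj : gen (J :\ j)%SET.
  have /setP/(_ j) := Jmin _ genJj (subD1set _ _).
  by rewrite jJ !inE eqxx.
apply/asboolP => i; have [b [b0 ->]] := genJ i.
exists (fun k => b k + b j * w k); split=> [k|].
  by rewrite addr_ge0 // mulr_ge0.
rewrite (big_setD1 j) //= {1}uE scaler_sumr -big_split /=.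
by apply: eq_bigr => k _; rewrite scalerDl scalerA addrC.
Qed.

Variables (J : {set 'I_m}) (c0 : 'rV[R]_n).
Hypothesis c0_pointed : forall i, i \in J -> dotv c0 (u i) < 0.
Hypothesis J_min : forall j, j \in J -> ~ cone (J :\ j)%SET (u j).

(** Otherwise Gordan's theorem modulo [u j] gives a nontrivial nonnegative combination of the other
    generators equal to [t *: u j]. If [t] is positive, this contradicts minimality; if not,
    applying [c0] gives a contradiction of signs. *)
Lemma generator_exposed j : j \in J ->
  exists2 d, dotv d (u j) = 0 &
    forall k, k \in J -> k != j -> dotv d (u k) < 0.
Proof.
move=> jJ.
have [[d dP dj]|[a a0 [[k kJ ak] /sub_rVP[t aE]]]] :=
    gordan_mod (J :\ j) u (u j).
  exists ((-1) *: d) => [|k kJ kj]; first by rewrite dotvZl dj ?mulr0.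
  by rewrite dotvZl mulN1r oppr_lt0; apply: dP; rewrite in_setD1 kj.
have [t0|t0] := ltrP 0 t.
  case: (J_min jJ); exists (fun i => if i \in (J :\ j)%SET then a i / t else 0).
  split=> [i|]; first by case: ifP => // /a0 ai; rewrite divr_ge0 // ltW.
  apply: (scalerI (lt0r_neq0 t0)); rewrite -aE scaler_sumr.
  apply: eq_bigr => i ->; rewrite scalerA mulrC divfK //.
  by rewrite gt_eqF.
have := congr1 (dotv c0) aE; rewrite dotvZr dotv_sumr => cE.
have : 0 <= t * dotv c0 (u j) by rewrite mulr_le0 // ltW // c0_pointed.
rewrite -cE (bigD1 k) //= dotvZr leNgt => /negP[].
have kJ' : k \in J by move: kJ; rewrite in_setD1 => /andP[].
rewrite ltr_wnDr //; last by rewrite pmulr_rlt0 // c0_pointed.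
apply: sumr_le0 => i /andP[iJ _]; rewrite dotvZr mulr_ge0_le0 ?a0 //.
by rewrite ltW // c0_pointed //; move: iJ; rewrite in_setD1 => /andP[].
Qed.

End Cone.

(** * Edges and edge basis at a vertex *)

Lemma has_dim0_set1 (R : realType) (n : nat) (v : 'rV[R]_n) : has_dim [set v] 0.
Proof.
split.
  by exists (fun=> v); split=> //; rewrite /row_free eqn_leq rank_leq_row.
move=> [p [pv]]; rewrite (_ : \matrix_i _ = 0) ?/row_free ?mxrank0 //.
by apply/matrixP => i j; rewrite !mxE !pv subrr.
Qed.

Lemma has_dim1_ray (R : realType) (n : nat) (S : set 'rV[R]_n) v w :
  S v -> S w -> v != w -> (forall x, S x -> exists t, x - v = t *: (w - v)) ->
  has_dim S 1.
Proof.
move=> Sv Sw vw Sray; split.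
  exists (fun i => if i == 0 then v else w); split; first by move=> i; case: ifP.
  rewrite -row_leq_rank lt0n mxrank_eq0; apply: contra vw => /eqP.
  move=> /matrixP/(_ 0) h; rewrite eq_sym -subr_eq0; apply/eqP/rowP => j.
  by have := h j; rewrite !mxE.
move=> [p [pS]]; rewrite -row_leq_rank; apply/negP; rewrite -leqNgt.
apply: leq_trans (rank_leq_row (w - v)); apply: mxrankS.
apply/row_subP => i; rewrite rowK.
have [[t tE] [s sE]] := (Sray _ (pS (lift ord0 i)), Sray _ (pS ord0)).
have -> : p (lift ord0 i) - p ord0 = (p (lift ord0 i) - v) - (p ord0 - v).
  by rewrite opprB addrA subrK.
by rewrite tE sE -scalerBl scalemx_sub.
Qed.

Section Vertex.
Variables (R : realType) (n m : nat) (a : 'I_m -> 'rV[R]_n) (i0 : 'I_m).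
Let v := a i0.
Let P := hull a.
Hypothesis v_face : is_face P [set v].

Let u i := a i - v.

(* Each member of a minimal generating set of the tangent cone at [v] spans an
   edge. *)
Lemma vertex_generators :
  ([set E : {classic (set 'rV[R]_n)} | E \in faces P 1 /\ [set v] `<=` E]
     #<= `I_n)%card ->
  exists2 J : {set 'I_m}, (#|J| <= n)%N & forall i, cone u J (u i).
Proof.
move=> edges; have [J [Jgen Jmin]] := minimal_generators u.
exists J => //.
have [c0 [b0 [cP [vE _]]]] := v_face.
have cv : dotv c0 v = b0 by have : [set v] v by []; rewrite vE => -[].
(* [c0] exposes [v] alone, so it is negative on every nonzero [u i]; this makes the tangent cone
   pointed. *)
have u0 i : dotv c0 (u i) = 0 -> u i = 0.
  move=> ci; apply/eqP; rewrite subr_eq0; apply/eqP; change ([set v] (a i)).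
  rewrite vE; split; first exact: hull_mem.
  by apply/eqP; rewrite -cv -subr_eq0 -dotvBr ci.
have c0J j : j \in J -> dotv c0 (u j) < 0.
  move=> jJ; rewrite lt_neqAle dotvBr subr_le0 cv cP ?andbT; last exact: hull_mem.
  rewrite -cv -dotvBr; apply/eqP => /u0 uj; case: (Jmin j jJ); rewrite uj.
  by exists (fun=> 0); split=> //; rewrite big1 // => i _; rewrite scale0r.
(* [E j] is the part of [P] on the ray from [v] through [a j], the candidate edge. *)
pose E j : {classic (set 'rV[R]_n)} :=
  [set x | P x /\ exists2 t, 0 <= t & x - v = t *: u j].
have Ev j : E j v.
  by split; [exact: hull_mem|exists 0; rewrite // subrr scale0r].
have Ea j : E j (a j).
  by split; [exact: hull_mem|exists 1; rewrite ?ler01 // scale1r].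
have E_edge j : j \in J -> E j \in faces P 1.
  move=> jJ; apply/mem_set; split; last first.
    apply: (has_dim1_ray (Ev j) (Ea j)) => [|x [_ [t _ tE]]]; last by exists t.
    by apply/eqP => va; have := c0J _ jJ; rewrite /u -va subrr dotv0r ltxx.
  have [d dj dJ] := generator_exposed c0J Jmin jJ.
  have dJ' k : k \in J -> dotv d (u k) <= 0.
    by have [->|kj] := eqVneq k j; [rewrite dj|move=> kJ; rewrite ltW // dJ].
  exists d, (dotv d v).
  have da i : dotv d (a i) <= dotv d v.
    have [w [w0 wE]] := Jgen i; rewrite -subr_le0 -dotvBr -/(u i) wE dotv_sumr.
    by apply: sumr_le0 => k kJ; rewrite dotvZr mulr_ge0_le0 // dJ'.
  split; first by move=> x; exact: hull_le.
  split; last by exists v; exact: Ev.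
  apply/seteqP; split=> x [Px].
    move=> [t _ xE]; split=> //; apply/eqP.
    by rewrite -subr_eq0 -dotvBr xE dotvZr dj mulr0.
  move=> dx; split=> //; have [w0 wx] := Px.
  have [w0_ge0 _ _] := wx.
  (* In the expansion of [x - v] over the generators, [d] is negative on all but [u j]; since [d]
     vanishes on [x - v], only the [u j] term survives. *)
  have [b [b0' bE]] := cone_sum w0_ge0 Jgen.
  rewrite (weights_sumB v wx) in bE; exists (b j) => //.
  rewrite bE (bigD1 j) //= big1 ?addr0 // => k /andP[kJ kj].
  have bd : \sum_(i in J) b i * dotv d (u i) = 0.
    have := dotvBr d x v; rewrite dx subrr bE dotv_sumr => dE.
    by rewrite -[RHS]dE; apply: eq_bigr => i _; rewrite dotvZr.
  have : \sum_(i in J) - (b i * dotv d (u i)) = 0 by rewrite sumrN bd oppr0.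
  move=> /eqP; rewrite psumr_eq0; last first.
    by move=> i iJ; rewrite oppr_ge0 mulr_ge0_le0 // dJ'.
  move=> /allP/(_ k (mem_index_enum k)); rewrite kJ /= oppr_eq0 mulf_eq0.
  by rewrite (lt_eqF (dJ k kJ kj)) orbF => /eqP->; rewrite scale0r.
(* If two of these edges coincided, [u k] would be a nonnegative multiple of [u j], against
   minimality. Hence [J] embeds in the set of edges at [v]. *)
have E_inj : {in J &, injective E}.
  move=> j k jJ kJ Ejk; apply/eqP/negPn/negP => jk.
  have := Ea k; rewrite -Ejk => -[_ [t t0 tE]].
  case: (Jmin k kJ); rewrite [X in cone _ _ X]tE.
  exists (fun i => if i == j then t else 0); split=> [i|]; first by case: ifP.
  rewrite (bigD1 j) ?in_setD1 ?jk //= eqxx big1 ?addr0 // => i /andP[_ /negPf->].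
  by rewrite scale0r.
rewrite -card_le_II; apply: card_le_trans edges.
rewrite (card_le_eql (@card_II #|J|)).
pose g (k : 'I_#|J|) := E (enum_val k).
have /card_le_eql <- : (range g #= [set: 'I_#|J|])%card.
  apply: inj_card_eq => k l _ _ /E_inj; rewrite !enum_valP => /(_ isT isT).
  exact: enum_val_inj.
apply: subset_card_le => _ [k _ <-]; split; last by move=> _ ->; exact: Ev.
exact/E_edge/enum_valP.
Qed.

Lemma vertex_basis : affdim_ge P n ->
  ([set E : {classic (set 'rV[R]_n)} | E \in faces P 1 /\ [set v] `<=` E]
     #<= `I_n)%card ->
  exists2 U : 'M[R]_n, U \in unitmx & (forall k, P (v + row k U)) /\
    forall x, P x -> forall k, 0 <= ((x - v) *m invmx U) 0 k.
Proof.
move=> [p [pP pfree]] /vertex_generators[J Jn Jgen].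
(* [J] could so far have fewer than [n] elements. The default [i0] pads [U] with rows [u i0 = 0],
   and full dimension then forces [U] to be invertible. *)
pose f (k : 'I_n) := nth i0 (enum J) k.
pose U := \matrix_(k < n) u (f k).
have UE x : P x -> exists2 b : 'rV_n, forall k, 0 <= b 0 k & x - v = b *m U.
  move=> [w wx]; have [w0 _ _] := wx.
  have [b [b0 bE]] := cone_sum w0 Jgen.
  exists (\row_k (if (k < #|J|)%N then b (f k) else 0)) => [k|].
    by rewrite mxE; case: ifP.
  rewrite -(weights_sumB v wx) bE mulmx_sum_row -big_enum /= (big_nth i0) big_mkord.
  pose g k := b (nth i0 (enum J) k) *: u (nth i0 (enum J) k).
  rewrite -cardE (big_ord_widen _ g Jn) /g.
  rewrite big_mkcond /=; apply: eq_bigr => k _; rewrite mxE rowK /f.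
  by case: ifP => // _; rewrite scale0r.
have Uunit : U \in unitmx.
  rewrite -row_free_unit -row_leq_rank.
  move: pfree; rewrite -row_leq_rank => /leq_trans; apply; apply: mxrankS.
  apply/row_subP => k; rewrite rowK.
  have [[b _ bE] [b' _ b'E]] := (UE _ (pP (lift ord0 k)), UE _ (pP ord0)).
  have -> : p (lift ord0 k) - p ord0 = (p (lift ord0 k) - v) - (p ord0 - v).
    by rewrite opprB addrA subrK.
  by rewrite bE b'E -mulmxBl submxMl.
exists U => //; split=> [k|x /UE[b b0 ->] k]; last by rewrite mulmxK.
by rewrite rowK addrC subrK; exact: hull_mem.
Qed.

End Vertex.

(** * Faces through a vertex, in edge coordinates *)

Section SimplicialVertex.
Variables (R : realType) (n : nat) (P : set 'rV[R]_n) (v : 'rV[R]_n).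
Variable U : 'M[R]_n.

Definition edge_coord x := (x - v) *m invmx U.

Hypothesis U_unit : U \in unitmx.
Hypothesis v_mem : P v.
Hypothesis step_mem : forall k, P (v + row k U).
Hypothesis coord_ge0 : forall x, P x -> forall k, 0 <= edge_coord x 0 k.
Implicit Types (K : {set 'I_n}) (F : set 'rV[R]_n).

Definition coord_face K : set 'rV[R]_n :=
  [set x | P x /\ forall k, k \in K -> edge_coord x 0 k = 0].

Lemma coord_vertex : edge_coord v = 0.
Proof. by rewrite /edge_coord subrr mul0mx. Qed.

Lemma coord_step k l : edge_coord (v + row k U) 0 l = (l == k)%:R.
Proof. by rewrite /edge_coord addrC addKr -row_mul mulmxV // !mxE eq_sym. Qed.

Lemma coordE x : x - v = \sum_k edge_coord x 0 k *: row k U.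
Proof. by rewrite -mulmx_sum_row mulmxKV. Qed.

Lemma vertex_coord_face K : coord_face K v.
Proof. by split=> // k _; rewrite coord_vertex mxE. Qed.

(** The points one step from [v] thus recover [K] from its face; injectivity, dimension and
    comparison of faces rest on this. *)
Lemma step_coord_face K k : coord_face K (v + row k U) <-> k \notin K.
Proof.
split=> [[_ h]|kK]; first by apply/negP => /h/eqP; rewrite coord_step eqxx oner_eq0.
split=> // l lK; rewrite coord_step; case: eqP => // lk.
by rewrite -lk lK in kK.
Qed.

Lemma coord_face_inj : injective coord_face.
Proof.
move=> K L KL; apply/setP => k; apply: negb_inj; apply/idP/idP.
  by move=> /step_coord_face; rewrite KL => /step_coord_face.
by move=> /step_coord_face; rewrite -KL => /step_coord_face.
Qed.

(** The supporting functional is minus the sum of the coordinates in [K]; as these are nonnegative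
    on [P], it is maximal only where all of them vanish. *)
Lemma is_face_coord_face K : is_face P (coord_face K).
Proof.
pose c := (-1) *: \sum_(k in K) (col k (invmx U))^T.
have cE x : dotv c x - dotv c v = - \sum_(k in K) edge_coord x 0 k.
  rewrite -dotvBr dotvZl mulN1r dotvC dotv_sumr; congr (- _).
  apply: eq_bigr => k _; rewrite /edge_coord !mxE.
  by apply: eq_bigr => i _; rewrite !mxE.
exists c, (dotv c v); split.
  by move=> x Px; rewrite -subr_le0 cE oppr_le0 sumr_ge0 // => k _; exact: coord_ge0.
split; last by exists v; exact: vertex_coord_face.
apply/seteqP; split=> x [Px] h; split=> //.
  by apply/eqP; rewrite -subr_eq0 cE big1 ?oppr0.
move=> k kK; move/eqP: h; rewrite -subr_eq0 cE oppr_eq0 psumr_eq0; last first.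
  by move=> l _; exact: coord_ge0.
by move=> /allP/(_ k (mem_index_enum k)); rewrite kK => /eqP.
Qed.

(** A functional maximal at [v] is nonpositive on every edge direction. Its maximum is attained
    exactly where the coordinates along its negative directions vanish. *)
Lemma face_at_vertex F : is_face P F -> F v -> exists K, F = coord_face K.
Proof.
move=> [c [b [cP [-> _]]]] [_ cv].
have cU k : dotv c (row k U) <= 0.
  by have := cP _ (step_mem k); rewrite dotvDr cv gerDl.
have cE x : dotv c x - b = - \sum_k edge_coord x 0 k * - dotv c (row k U).
  rewrite -cv -dotvBr coordE dotv_sumr -sumrN.
  by apply: eq_bigr => k _; rewrite dotvZr mulrN opprK.
exists [set k | dotv c (row k U) != 0]%SET.
apply/seteqP; split=> x [Px] h; split=> //.
  move=> k; rewrite inE => ck; move/eqP: h; rewrite -subr_eq0 cE oppr_eq0.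
  rewrite psumr_eq0; last first.
    by move=> l _; rewrite mulr_ge0 ?oppr_ge0 //; exact: coord_ge0.
  move=> /allP/(_ k (mem_index_enum k)).
  by rewrite mulf_eq0 oppr_eq0 (negPf ck) orbF => /eqP.
apply/eqP; rewrite -subr_eq0 cE big1 ?oppr0 // => k _.
have [->|ck] := eqVneq (dotv c (row k U)) 0; first by rewrite oppr0 mulr0.
by rewrite h ?mul0r // inE.
Qed.

Lemma affdim_ge_coord_face K k : affdim_ge (coord_face K) k <-> (k <= n - #|K|)%N.
Proof.
have cardK : (n - #|K|)%N = #|~: K|.
  by rewrite [RHS]cardsCs card_ord finset.setCK.
rewrite cardK; split=> [[p [pK]]|kK].
  rewrite -row_leq_rank => /leq_trans; apply.
  (* In edge coordinates the differences of points of the face are supported outside [K], so [N]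
     factors through the [#|~: K|] rows of [S]. *)
  set M := \matrix_i _; pose N := M *m invmx U.
  pose S := \matrix_(j < #|~: K|) (delta_mx 0 (enum_val j) : 'rV[R]_n).
  have NE : N = (\matrix_(i, j) N i (enum_val j)) *m S.
    apply/matrixP => i l; rewrite [RHS]mxE.
    transitivity (\sum_(j < #|~: K|) N i (enum_val j) * (l == enum_val j)%:R); last first.
      by apply: eq_bigr => j _; rewrite [_ i j]mxE [S j l]mxE [delta_mx _ _ _ _]mxE.
    rewrite -(big_enum_val (fun m => N i m * (l == m)%:R)) /=.
    have [lK|lK] := boolP (l \in ~: K).
      rewrite (bigD1 l) //= eqxx mulr1 big1 ?addr0 // => m /andP[_].
      by rewrite eq_sym => /negPf->; rewrite mulr0.
    rewrite big1 => [|m mK]; last first.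
      case: eqP => [lm|_]; last by rewrite mulr0.
      by move: lK; rewrite lm mK.
    have rowN : row i N = edge_coord (p (lift ord0 i)) - edge_coord (p ord0).
      by rewrite /N row_mul rowK /edge_coord -mulmxBl opprB addrA subrK.
    have -> : N i l = edge_coord (p (lift ord0 i)) 0 l - edge_coord (p ord0) 0 l.
      transitivity (row i N 0 l); first by rewrite [RHS]mxE.
      by rewrite rowN [LHS]mxE [X in _ + X]mxE.
    rewrite finset.in_setC negbK in lK.
    by have [[_ ->//] [_ ->//]] := (pK (lift ord0 i), pK ord0); rewrite subrr.
  by rewrite -(mulmxKV U_unit M) -/N NE -mulmxA mulmx_max_rank.
pose e (j : 'I_k) := enum_val (widen_ord kK j).
have e_inj : injective e by move=> i j /enum_val_inj/(congr1 val)/= /val_inj.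
(* Conversely, [v] and its steps along [k] directions outside [K] are affinely independent. *)
exists (fun i => if unlift ord0 i is Some j then v + row (e j) U else v).
split=> [i|].
  case: unliftP => [j _|_]; last exact: vertex_coord_face.
  by apply/step_coord_face; have := enum_valP (widen_ord kK j); rewrite finset.in_setC.
set M := \matrix_i _.
pose E := \matrix_(i < k) (delta_mx 0 (e i) : 'rV[R]_n).
have ME : M = E *m U.
  apply/row_matrixP => i; rewrite row_mul !rowK liftK unlift_none -rowE.
  by rewrite addrC addKr.
apply/row_freeP; exists (invmx U *m E^T); rewrite ME mulmxA mulmxK //.
apply/matrixP => i j; rewrite mxE (bigD1 (e i)) //= big1 => [|l lei].
  by rewrite !mxE !eqxx mul1r addr0 (inj_eq e_inj).
by rewrite !mxE /= (negPf lei) mul0r.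
Qed.

Lemma has_dim_coord_face K k : has_dim (coord_face K) k <-> k = (n - #|K|)%N.
Proof.
rewrite /has_dim !affdim_ge_coord_face; split=> [[h1 /negP h2]|->].
  by apply/eqP; rewrite eqn_leq h1 leqNgt.
by rewrite ltnn.
Qed.

Section Through.
Variable x : 'rV[R]_n.
Hypothesis x_mem : P x.
Hypothesis through_vertex : forall F, is_face P F -> F x -> F v.
Let K := [set k | edge_coord x 0 k == 0]%SET.

Lemma coord_face_through J : coord_face J x <-> J \subset K.
Proof.
split=> [[_ h]|/fintype.subsetP JK]; first by apply/fintype.subsetP => k /h; rewrite inE => ->.
by split=> // k /JK; rewrite inE => /eqP.
Qed.

Lemma faces_through k F :
  (faces P k F /\ F x) <->
    (exists2 J : {set 'I_n}, J \subset K /\ k = (n - #|J|)%N & F = coord_face J).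
Proof.
split=> [[[Ff Fk] Fx]|[J [JK ->] ->]].
  have [J FJ] := face_at_vertex Ff (through_vertex Ff Fx).
  exists J => //; split; first by apply/coord_face_through; rewrite -FJ.
  by apply/has_dim_coord_face; rewrite -FJ.
split; last exact/coord_face_through.
by split; [exact: is_face_coord_face|exact/has_dim_coord_face].
Qed.

(** A face [coord_face J] with [x] in its relative interior has [J] inside [K] because it contains
    [x]. It also lies in [coord_face K], a face through [x], whence [K] is inside [J]. *)
Lemma faces_relint k F : (exists2 G, is_face P G & relint G x) ->
  (faces P k F /\ relint F x) <-> (k = (n - #|K|)%N /\ F = coord_face K).
Proof.
have relint_eq G : is_face P G -> relint G x -> G = coord_face K.
  move=> Gf Gx; have [J GJ] := face_at_vertex Gf (through_vertex Gf Gx.1).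
  suff -> : K = J by [].
  apply/eqP; rewrite finset.eqEsubset; apply/andP; split.
    apply/fintype.subsetP => l lK; apply/negPn/negP => /step_coord_face.
    have GP : G `<=` P by rewrite GJ => y [].
    have xK : coord_face K x by exact/coord_face_through.
    have := relint_sub_face GP (is_face_coord_face K) Gx xK.
    by rewrite -GJ => GK /GK/step_coord_face; rewrite lK.
  by apply/coord_face_through; rewrite -GJ; exact: Gx.1.
move=> [G Gf Gx]; split=> [[[Ff Fk] Fx]|[-> ->]].
  rewrite (relint_eq F) //; split=> //; apply/has_dim_coord_face.
  by rewrite -(relint_eq F).
rewrite -(relint_eq G) //; split=> //; split=> //.
by rewrite (relint_eq G) // has_dim_coord_face.
Qed.

End Through.
End SimplicialVertex.

(** Both sides are the coefficient of [t^p] in [(1 + t)^(n - m) * ((1 + t) - t)^m]. The induction on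
    [m] uses Pascal's rule on both sides. *)
Lemma alternating_bin_sum (A : comPzRingType) (n m p : nat) : (m <= n)%N ->
  \sum_(j < p.+1) (-1) ^+ j * 'C(n - j, p - j)%:R * 'C(m, j)%:R
    = 'C(n - m, p)%:R :> A.
Proof.
elim: m n p => [|m IH] n p mn.
  rewrite big_ord_recl !subn0 bin0 expr0 mul1r mulr1 big1 ?addr0 // => j _.
  by rewrite bin0n mulr0.
case: p => [|p]; first by rewrite big_ord1 /= !bin0 expr0 !mulr1.
case: n mn => // n mn; rewrite subSS.
have := IH n.+1 p.+1 (ltnW mn); rewrite subSn // binS natrD => IH1.
have := IH n p mn => IH2.
apply: (addIr 'C(n - m, p)%:R); rewrite -IH1 -{}IH2.
rewrite big_ord_recl [in RHS]big_ord_recl !bin0 -addrA; congr (_ + _).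
rewrite -big_split /=; apply: eq_bigr => j _.
rewrite /bump /= !add1n !subSS binS natrD exprS; ring.
Qed.

Lemma conv_hull (R : realType) (n : nat) (V : seq 'rV[R]_n) :
  conv V = hull (fun i : 'I_(size V) => V`_i).
Proof.
apply/seteqP; split=> x [w]; first by move=> [w0 [w1 xE]]; exists w.
by move=> [w0 w1 xE]; exists w.
Qed.

Lemma fsum1_finset (T : finType) (A : {set T}) :
  \sum_(i \in [set` A]) (1 : int) = #|A|%:R.
Proof.
rewrite (@fsbigE _ _ _ _ _ (enum A)) ?enum_uniq //; last 2 first.
- by move=> i /=; rewrite mem_enum.
- by move=> i /= iA; rewrite mem_enum iA.
rewrite big_mkcond -sumr_const -[RHS]big_enum /=; apply: eq_big_seq => i.
by rewrite mem_enum => iA; rewrite mem_set.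
Qed.

(** * Counting the faces at a point *)

Section Points.
Variables (R : realType) (n m : nat) (a : 'I_m -> 'rV[R]_n).
Let P := hull a.

(** A face is determined by the set of generators lying on it. Finiteness is what allows the sums
    over faces and points to be exchanged. *)
Lemma finite_faces k : finite_set (faces P k).
Proof.
pose f (T : {set 'I_m}) : {classic (set 'rV[R]_n)} :=
  [set x | exists2 w, weights a w x & forall i, 0 < w i -> i \in T].
apply: (@sub_finite_set _ _ (f @` setT)); last exact/finite_image/finite_finset.
move=> F [[c [b [cP [FE _]]]] _].
have ca i : dotv c (a i) <= b by apply: cP; exact: hull_mem.
exists [set i | dotv c (a i) == b]%SET => //; rewrite FE.
apply/seteqP; split=> x.
  move=> [w wx wT]; split; first by exists w.
  apply/eqP; rewrite eq_sym -subr_eq0 -(weights_dotvB _ _ wx).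
  have [w0 _ _] := wx; apply/eqP; apply: big1 => i _.
  have [wi|wi] := ltrP 0 (w i).
    by have := wT i wi; rewrite inE => /eqP->; rewrite subrr mulr0.
  by have -> : w i = 0; [apply/le_anti; rewrite wi w0|rewrite mul0r].
move=> [[w wx] cx]; exists w => // i wi.
by rewrite inE (weights_face ca wx cx wi).
Qed.

Lemma finite_lattice_points : finite_set [set z : 'rV[int]_n | P (intpt R z)].
Proof.
pose S := \sum_i \sum_k `|a i 0 k|.
have S0 : 0 <= S by apply: sumr_ge0 => i _; apply: sumr_ge0.
have [N SN] : exists N : nat, S < N%:R by exists (Num.bound S); exact: archi_boundP.
(* The coordinates of lattice points of [P] lie between [- N] and [N]; shifting by [N] encodes them
   as ordinals. *)
pose f (g : {ffun 'I_n -> 'I_(N + N).+1}) : 'rV[int]_n := \row_k ((g k)%:Z - N%:Z).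
apply: (@sub_finite_set _ _ (f @` setT)); last exact/finite_image/finite_finset.
move=> z [w [w0 w1 zE]].
have zN k : `|z 0 k| <= N%:Z.
  suff : `|(z 0 k)%:~R : R| <= N%:R by rewrite -intr_norm -(ler_int R).
  have -> : (z 0 k)%:~R = \sum_i w i * a i 0 k.
    have /rowP/(_ k) := zE; rewrite mxE summxE => ->.
    by apply: eq_bigr => i _; rewrite mxE.
  apply: le_trans (ltW SN); apply: le_trans (ler_norm_sum _ _ _) _.
  apply: ler_sum => i _; rewrite normrM (ger0_norm (w0 i)).
  have wi1 : w i <= 1 by rewrite -w1 (bigD1 i) //= lerDl sumr_ge0.
  apply: (@le_trans _ _ `|a i 0 k|); first by rewrite ler_piMl.
  by rewrite (bigD1 k) //= lerDl sumr_ge0.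
exists [ffun k => inord (absz (z 0 k + N%:Z))] => //.
apply/rowP => k; rewrite !mxE ffunE; have := zN k => zk.
by rewrite inordK; lia.
Qed.

Hypothesis P_dim : has_dim P n.
Hypothesis P_simple : simple_polytope P.

(** Every face through [x] contains the face carrying [x], hence any vertex of it, so edge
    coordinates at such a vertex describe them all. Here [d] is the dimension of the carrying face,
    and [n - d] the number of zero coordinates of [x]. *)
Lemma point_faces x : P x -> exists2 d : nat, (d <= n)%N &
  (forall j, (j <= n)%N ->
    \sum_(F \in faces P (n - j) `&` [set F | F x]) (1 : int) = 'C(n - d, j)%:R) /\
  (forall k, \sum_(F \in faces P k `&` [set F | relint F x]) (1 : int)
     = (k == d)%:R).
Proof.
move=> Px; have [G [Gf Gx]] := carrier_face Px.
have [i0 vf Gv] := face_vertex Gf.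
have GP : G `<=` P by move: Gf => [c [b [_ [-> _]]]] y [].
have through F : is_face P F -> F x -> F (a i0).
  by move=> Ff Fx; exact: (relint_sub_face GP Ff Gx Fx) _ Gv.
have edges := P_simple (mem_set (conj vf (has_dim0_set1 (a i0)))).
rewrite card_eq_le in edges; have /andP[edges_le _] := edges.
have [U Uu [Ustep Uge]] := vertex_basis vf P_dim.1 edges_le.
have vP : P (a i0) := hull_mem a i0.
pose K := [set k | edge_coord (a i0) U x 0 k == 0]%SET.
have Kn : (#|K| <= n)%N by rewrite -[leqRHS]card_ord max_card.
exists (n - #|K|)%N; first exact: leq_subr.
pose f : {set 'I_n} -> {classic (set 'rV[R]_n)} := coord_face P (a i0) U.
split=> [j jn|k].
  rewrite subKn //.
  have -> : faces P (n - j) `&` [set F | F x] =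
      f @` [set` [set J : {set 'I_n} | J \subset K & #|J| == j]%SET].
    apply/seteqP; split=> F.
      move=> /(faces_through Uu vP Ustep Uge Px through)[J [JK Jj] ->].
      exists J => //=; rewrite inE JK /=; apply/eqP.
      have Jn : (#|J| <= n)%N by rewrite -[leqRHS]card_ord max_card.
      by rewrite -(subKn Jn) -Jj subKn.
    move=> [J /=]; rewrite inE => /andP[JK /eqP Jj] <-.
    by apply/(faces_through Uu vP Ustep Uge Px through); exists J; rewrite ?Jj.
  rewrite fsbig_image; last first.
    by move=> J L _ _; apply: coord_face_inj.
  by rewrite fsum1_finset cards_draws.
have relintE l F := faces_relint Uu vP Ustep Uge Px through l F (ex_intro2 _ _ G Gf Gx).
have [->|kK] := eqVneq k (n - #|K|)%N.
  rewrite (_ : _ `&` _ = [set f K]) ?fsbig_set1 //.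
  apply/seteqP; split=> F /=; first by case/(relintE _ F).
  by move=> ->; apply/(relintE _ (f K)).
rewrite (_ : _ `&` _ = set0) ?fsbig_set0 //.
by apply/seteqP; split=> F //= /(relintE _ F)[kE]; rewrite kE eqxx in kK.
Qed.

End Points.

(** * Exchanging the sums over faces and lattice points *)

Unset Implicit Arguments.

Theorem theorem6p2 (R : realType) (n : nat) (V : seq 'rV[int]_n) (p : nat) :
  let D : set 'rV[R]_n := lattice_polytope V in
  has_dim D n -> simple_polytope D -> (p <= n)%N ->
  \sum_(j < p.+1)
     (-1) ^+ j * ('C(n - j, p - j))%:R * \sum_(F \in faces D (n - j)) lpts F
  = \sum_(p <= s < n.+1) ('C(s, p))%:R * \sum_(G \in faces D s) lpts_int G.
Proof.
move=> D; rewrite {}/D /lattice_polytope conv_hull.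
set a := fun i => _; set D := hull a => D_dim D_simple pn.
set A := [set z : 'rV[int]_n | D (intpt R z)].
have A_fin : finite_set A by exact: finite_lattice_points.
(* With [rel] the identity this treats [lpts], and with [relint] it treats [lpts_int]. *)
have count (k : nat) (rel : set 'rV[R]_n -> set 'rV[R]_n) :
    (forall F, rel F `<=` F) ->
    \sum_(F \in faces D k) ncard [set z : 'rV[int]_n | rel F (intpt R z)] =
    \sum_(z <- finmap.enum_fset (fset_set A))
      \sum_(F \in faces D k `&` [set F | rel F (intpt R z)]) (1 : int).
  move=> relF; rewrite -fsbig_finite //.
  under [RHS]eq_fsbigr do rewrite fsbig_mkcondr.
  rewrite exchange_fsbig //; last exact: finite_faces.
  apply: eq_fsbigr => F /set_mem[[c [b [_ [FE _]]]] _].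
  rewrite /ncard (_ : [set z | _] = A `&` [set z | rel F (intpt R z)]).
    by rewrite fsbig_mkcondr; apply: eq_fsbigr => z _.
  apply/seteqP; split=> z; last by case.
  move=> rz; split=> //.
  by have := relF _ _ rz; rewrite FE => -[].
have id_sub (F : set 'rV[R]_n) : id F `<=` F by [].
have relint_sub (F : set 'rV[R]_n) : relint F `<=` F by move=> x [].
under eq_bigr do rewrite (count _ id id_sub) mulr_sumr.
under [RHS]eq_bigr do rewrite (count _ _ relint_sub) mulr_sumr.
rewrite exchange_big [RHS]exchange_big /=; apply: eq_big_seq => z.
rewrite in_fset_set // => /set_mem Az.
have [d dn [thr rel]] := point_faces D_dim D_simple Az.
(* The contribution of [z] to either side is ['C(d, p)]; on the left this is the binomial identity
   with [m = n - d]. *)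
transitivity ('C(d, p)%:R : int).
  rewrite -(subKn dn) -alternating_bin_sum ?leq_subr //; apply: eq_bigr => j _.
  by rewrite thr // (leq_trans _ pn) // -ltnS.
under eq_bigr do rewrite rel.
(* On the right only [s = d] contributes. If [d < p] it is out of range, and ['C(d, p)] is 0. *)
have [pd|dp] := leqP p d; last first.
  rewrite bin_small // big_nat big1 // => s /andP[ps _].
  by rewrite gtn_eqF ?mulr0 // (leq_trans dp).
rewrite (bigD1_seq d) ?mem_index_iota ?pd ?iota_uniq //= eqxx mulr1.
by rewrite big1 ?addr0 // => s /negPf->; rewrite mulr0.
Qed.
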